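(* Let $(X,\rho)$ be a geometrically doubling quasi-metric space with constants $A_0,A_1$. Suppose $\delta\in(0,1)$ satisfies $144A_0^8\delta\le1$, and let a set of reference points $\{x^k_\alpha\}$, $k\in\mathbb{Z}$, $\alpha\in\mathscr{A}_k$, be given. Then there exist a finite number $K=K(A_0,A_1,\delta)$ and a probability space $(\Omega,\mathbb{P})$ such that every $\omega\in\Omega$ defines a family of dyadic systems $(\mathscr{D}^t(\omega))_{t=1}^K$, where each $\mathscr{D}^t(\omega)=\{{}^tQ^k_\alpha(\omega)\}_{k,\alpha}$, related to new dyadic points $\{{}^tz^k_\alpha(\omega)\}_{k,\alpha}$, satisfies the dyadic properties (1)--(5) listed in the context. Further: (i) for every $\omega\in\Omega$, and every ball $B=B(x,r)\subseteq X$, there exist $t\in\{1,\ldots,K\}$ and $Q\in\mathscr{D}^t(\omega)$ such that $B\subseteq Q$ and $\operatorname{diam}(Q)\le Cr$, where $C=C(A_0,\delta)$ is a constant independent of $x$ and $t$; (ii) for every $t\in\{1,\ldots,K\}$, the family $(\mathscr{D}^t(\omega))_{\omega\in\Omega}$ satisfies: (a) $\Omega=\prod_{k\in\mathbb{Z}}\Omega_k$, each $\omega=(\omega_k)_{k\in\mathbb{Z}}\in\Omega$ having coordinates $\omega_k\in\Omega_k$ which are independent; (b) ${}^tz^k_\alpha(\omega)={}^tz^k_\alpha(\omega_k)$, i.e. ${}^tz^k_\alpha(\omega)$ depends on $\omega$ only through $\omega_k$; (c) there is a constant $\tau_0>0$ such that, whenever $(k+1,\beta)\le(k,\alpha)$,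 $\mathbb{P}(\{\omega\in\Omega:{}^tz^k_\alpha(\omega)=x^{k+1}_\beta\})\ge\tau_0$.
   Context: A quasi-metric $\rho$ on $X$ satisfies the axioms of a metric except that the triangle inequality is weakened to $\rho(x,y)\le A_0(\rho(x,z)+\rho(z,y))$ with $A_0\ge1$. Balls are $B(x,r):=\{y\in X:\rho(y,x)<r\}$, $r>0$. Geometric doubling: there is $A_1\in\mathbb{N}$ such that every ball $B(x,r)$ can be covered by at most $A_1$ balls of radius $r/2$. A set $\Omega'$ is open if each $x\in\Omega'$ has some $B(x,\varepsilon)\subseteq\Omega'$, $\varepsilon>0$; interior and closure refer to this topology. $\operatorname{diam}(Q):=\sup_{x,y\in Q}\rho(x,y)$. Reference points (for the given $\delta$): for every $k\in\mathbb{Z}$ a family $\{x^k_\alpha\}_{\alpha\in\mathscr{A}_k}\subseteq X$, $\mathscr{A}_k$ countable, with $\rho(x^k_\alpha,x^k_\beta)\ge\delta^k$ for $\alpha\ne\beta$ and $\min_\alpha\rho(x,x^k_\alpha)<\delta^k$ for all $x\in X$. A partial order $\le$ on index pairs is fixed: each $(k+1,\beta)$ has exactly one parent $(k,\alpha)$, written $(k+1,\beta)\le(k,\alpha)$, chosen so that $\rho(x^{k+1}_\beta,x^k_\alpha)<(2A_0)^{-1}\delta^k$ implies $(k+1,\beta)\le(k,\alpha)$, and $(k+1,\beta)\le(k,\alpha)$ implies $\rho(x^{k+1}_\beta,x^k_\alpha)<\delta^k$; $\le$ is extended to all levels by reflexivity and transitivity. If $(k+1,\beta)\le(k,\alpha)$,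 then $(k+1,\beta)$ is called a child of $(k,\alpha)$. Constants: $c_0:=(4A_0^2)^{-1}$, $C_0:=2A_0$, $c_1:=(3A_0^2)^{-1}c_0$, $C_1:=2A_0C_0$. New dyadic points are points $z^k_\alpha$, $k\in\mathbb{Z}$, $\alpha\in\mathscr{A}_k$, each of the form $z^k_\alpha=x^{k+1}_\beta$ for some child $(k+1,\beta)\le(k,\alpha)$, such that $\rho(z^k_\alpha,z^k_\beta)\ge c_0\delta^k$ for $\alpha\neq\beta$ and $\min_\alpha\rho(x,z^k_\alpha)<C_0\delta^k$ for all $x\in X$. Dyadic system related to new dyadic points $\{z^k_\alpha\}$: the points determine their own partial order $\preceq$: with $\mathscr{A}_k\subseteq\mathbb{N}$, the parent of $(k+1,\beta)$ is the unique $(k,\alpha)$ with $\rho(z^{k+1}_\beta,z^k_\alpha)<(2A_0)^{-1}c_0\delta^k$ if it exists, and otherwise the $(k,\alpha)$ with smallest $\alpha$ such that $\rho(z^{k+1}_\beta,z^k_\alpha)<C_0\delta^k$; extend by reflexivity and transitivity. Put $\hat Q^k_\alpha:=\{z^\ell_\beta:(\ell,\beta)\preceq(k,\alpha)\}$, let $\bar Q^k_\alpha$ be the closure of $\hat Q^k_\alpha$, and $\tilde Q^k_\alpha:=X\setminus\bigcup_{\beta\ne\alpha}\bar Q^k_\beta$. The system consists of (half-open) cubes $Q^k_\alpha$ with $\tilde Q^k_\alpha\subseteq Q^k_\alpha\subseteq\bar Q^k_\alpha$. Dyadic properties: (1) $\tilde Q^k_\alpha$ and $\bar Q^k_\alpha$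 are the interior and closure of $Q^k_\alpha$; (2) if $\ell\ge k$, then either $Q^\ell_\beta\subseteq Q^k_\alpha$ or $Q^k_\alpha\cap Q^\ell_\beta=\varnothing$; (3) $X=\bigcup_\alpha Q^k_\alpha$ (disjoint union) for every $k$; (4) $B(z^k_\alpha,c_1\delta^k)\subseteq Q^k_\alpha\subseteq B(z^k_\alpha,C_1\delta^k)=:B(Q^k_\alpha)$; (5) if $k\le\ell$ and $Q^\ell_\beta\subseteq Q^k_\alpha$, then $B(Q^\ell_\beta)\subseteq B(Q^k_\alpha)$. *)

(* Defs.v *)
From HB Require Import structures.
From Stdlib Require Import Relation_Definitions Relation_Operators.
From mathcomp Require Import all_boot all_order all_algebra.
From mathcomp Require Import all_classical all_reals all_analysis.

Set Implicit Arguments.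
Unset Strict Implicit.
Unset Printing Implicit Defensive.

Import Order.TTheory GRing.Theory Num.Theory.
Local Open Scope classical_set_scope.
Local Open Scope ring_scope.

Section QuasiMetric.
Context {R : realType} {X : Type}.
Implicit Type rho : X -> X -> R.

Definition quasi_metric (A0 : R) rho : Prop :=
  [/\ forall x y, 0 <= rho x y,
      forall x y, rho x y = 0 <-> x = y,
      forall x y, rho x y = rho y x
    & forall x y z, rho x y <= A0 * (rho x z + rho z y)].

Definition qball rho (x : X) (r : R) : set X := [set y | rho y x < r].

Definition geometrically_doubling rho (A1 : nat) : Prop :=
  forall (x : X) (r : R), 0 < r -> exists c : seq X,
    (size c <= A1)%N /\
    qball rho x r `<=` [set y | exists i : 'I_(size c),
                                  qball rho (nth x c i) (r / 2) y].

Definition qopen rho : set (set X) :=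
  [set U | forall x, U x -> exists2 e : R, 0 < e & qball rho x e `<=` U].

Definition qdiam rho (Q : set X) : \bar R :=
  ereal_sup [set d | exists u v, [/\ Q u, Q v & d = (rho u v)%:E]].

(* The carrier X with the topology of rho. [qopen rho] is a topology for any
   function rho; balls need not belong to it, even for a quasi-metric. *)
Definition qspace rho : Type := X.

End QuasiMetric.

Section QspaceTopology.
Context {R : realType} {X : Type} (rho : X -> X -> R).

Let qopenT : qopen rho setT.
Proof. by move=> x _; exists 1. Qed.

Let qopenI : setI_closed (qopen rho).
Proof.
move=> U V oU oV x [Ux Vx].
have [e e0 eU] := oU x Ux; have [f f0 fV] := oV x Vx.
exists (Num.min e f); first by rewrite lt_min e0 f0.
by move=> y; rewrite /qball /= lt_min => /andP[ye yf]; split; [exact: eU|exact: fV].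
Qed.

Let qopen_bigU (I : Type) (f : I -> set X) :
  (forall i, qopen rho (f i)) -> qopen rho (\bigcup_i f i).
Proof.
move=> of_ x [i _ fix_]; have [e e0 ef] := of_ i x fix_.
by exists e => // y /ef; exists i.
Qed.

HB.instance Definition _ := gen_eqMixin (qspace rho).
HB.instance Definition _ := gen_choiceMixin (qspace rho).
HB.instance Definition _ :=
  isOpenTopological.Build (qspace rho) qopenT qopenI qopen_bigU.

End QspaceTopology.

(* Index sets: the countable set of labels at level k is A k, a subset of nat,
   and the index pair (k, alpha) is an element of int * nat. Values of the
   families below at labels outside A k are irrelevant. *)

(* [attained_min_lt S f c] says that min_(a in S) f a exists and is < c. *)
Definition attained_min_lt {R : realType} (S : set nat) (f : nat -> R) (c : R)
  : Prop :=
  exists a, [/\ S a, forall b, S b -> f a <= f b & f a < c].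

(* The order generated by a parent relation: [parent k b a] is read as
   "(k, a) is the parent of (k + 1, b)". [tree_le A parent p q] is p <= q, so
   p is the finer index. *)
Definition tree_step (A : int -> set nat) (parent : int -> nat -> nat -> Prop) :
    relation (int * nat) :=
  fun p q => [/\ p.1 = q.1 + 1, A p.1 p.2, A q.1 q.2 & parent q.1 p.2 q.2].

Definition tree_le (A : int -> set nat) (parent : int -> nat -> nat -> Prop) :
    relation (int * nat) :=
  clos_refl_trans (int * nat) (tree_step A parent).

Section Constants.
Context {R : realType}.
Variable A0 : R.

Definition cst_c0 : R := (4 * A0 ^+ 2)^-1.
Definition cst_C0 : R := 2 * A0.
Definition cst_c1 : R := (3 * A0 ^+ 2)^-1 * cst_c0.
Definition cst_C1 : R := 2 * A0 * cst_C0.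

End Constants.

Section Dyadic.
Context {R : realType} {X : Type}.
Variables (rho : X -> X -> R) (A0 delta : R) (A : int -> set nat).
Implicit Types (x z : int -> nat -> X) (parent : int -> nat -> nat -> Prop).

Definition reference_points x : Prop :=
  (forall k a b, A k a -> A k b -> a <> b ->
     delta ^ k <= rho (x k a) (x k b)) /\
  (forall k y, attained_min_lt (A k) (fun a => rho y (x k a)) (delta ^ k)).

Definition reference_parent x parent : Prop :=
  [/\ forall k b, A (k + 1) b -> exists! a, A k a /\ parent k b a,
      forall k a b, A k a -> A (k + 1) b ->
        rho (x (k + 1) b) (x k a) < (2 * A0)^-1 * delta ^ k -> parent k b a
    & forall k a b, A k a -> A (k + 1) b -> parent k b a ->
        rho (x (k + 1) b) (x k a) < delta ^ k].

Definition new_dyadic_points x parent z : Prop :=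
  [/\ forall k a, A k a -> exists b,
        [/\ A (k + 1) b, tree_le A parent (k + 1, b) (k, a)
          & z k a = x (k + 1) b],
      forall k a b, A k a -> A k b -> a <> b ->
        cst_c0 A0 * delta ^ k <= rho (z k a) (z k b)
    & forall k y,
        attained_min_lt (A k) (fun a => rho y (z k a)) (cst_C0 A0 * delta ^ k)].

Section RelatedSystem.
Variable z : int -> nat -> X.

(* At most one index satisfies [close_parent k b], by the c_0 delta^k separation
   of the points z k a. *)
Definition close_parent (k : int) (b a : nat) : Prop :=
  A k a /\
  rho (z (k + 1) b) (z k a) < (2 * A0)^-1 * cst_c0 A0 * delta ^ k.

Definition far_parent (k : int) (b a : nat) : Prop :=
  A k a /\ rho (z (k + 1) b) (z k a) < cst_C0 A0 * delta ^ k.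

Definition new_parent (k : int) (b a : nat) : Prop :=
  close_parent k b a \/
  [/\ ~ (exists a', close_parent k b a'),
      far_parent k b a
    & forall a', far_parent k b a' -> (a <= a')%N].

Definition hat_cube (k : int) (a : nat) : set (qspace rho) :=
  [set y | exists l b, [/\ A l b, tree_le A new_parent (l, b) (k, a)
                         & y = z l b]].

Definition bar_cube (k : int) (a : nat) : set (qspace rho) :=
  closure (hat_cube k a).

Definition tilde_cube (k : int) (a : nat) : set (qspace rho) :=
  ~` \bigcup_(b in A k `\ a) bar_cube k b.

Definition dyadic_system (Q : int -> nat -> set (qspace rho)) : Prop :=
  forall k a, A k a -> tilde_cube k a `<=` Q k a /\ Q k a `<=` bar_cube k a.

Definition ball_of_cube (k : int) (a : nat) : set X :=
  qball rho (z k a) (cst_C1 A0 * delta ^ k).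

Definition dyadic_properties (Q : int -> nat -> set (qspace rho)) : Prop :=
  [/\ forall k a, A k a ->
        interior (Q k a) = tilde_cube k a /\ closure (Q k a) = bar_cube k a,
      forall k l a b, A k a -> A l b -> k <= l ->
        Q l b `<=` Q k a \/ Q k a `&` Q l b = set0,
      forall k, \bigcup_(a in A k) Q k a = setT /\ trivIset (A k) (Q k),
      forall k a, A k a ->
        qball rho (z k a) (cst_c1 A0 * delta ^ k) `<=` Q k a /\
        Q k a `<=` ball_of_cube k a
    & forall k l a b, A k a -> A l b -> k <= l -> Q l b `<=` Q k a ->
        ball_of_cube l b `<=` ball_of_cube k a].

End RelatedSystem.
End Dyadic.

Arguments dyadic_system {R X} rho A0 delta A z Q.
Arguments dyadic_properties {R X} rho A0 delta A z Q.

(* The product of the Om k over k : int, with the product sigma-algebra, i.e.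
   the one generated by the coordinate projections. *)
Definition cylinders (d : int -> measure_display)
    (Om : forall k, measurableType (d k)) : set (set (forall k, Om k)) :=
  [set C | exists k (E : set (Om k)),
     measurable E /\ C = [set w | E (w k)]].

Arguments cylinders {d} Om.

Notation product_space Om := (g_sigma_algebraType (cylinders Om)).

Definition independent_coordinates {R : realType} (d : int -> measure_display)
    (Om : forall k, measurableType (d k))
    (P : probability (product_space Om) R) : Prop :=
  forall (J : seq int) (E : forall k, set (Om k)), uniq J ->
    (forall k, measurable (E k)) ->
    P [set w | forall k, k \in J -> E k (w k)] =
    (\prod_(k <- J) P [set w | E k (w k)])%E.

(* Main.v *)
From HB Require Import structures.
Require Import Defs.
From Stdlib Require Import Relation_Operators Operators_Properties.
From mathcomp Require Import all_boot all_order all_algebra.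
From mathcomp Require Import all_classical all_reals all_analysis.
From mathcomp Require Import zify ring lra.

Set Implicit Arguments.
Unset Strict Implicit.
Unset Printing Implicit Defensive.

Import Order.TTheory GRing.Theory Num.Theory.
Local Open Scope classical_set_scope.
Local Open Scope ring_scope.

(** Each new dyadic point is chosen among the children of the old one, and the
    choice at level k is governed by a colour.  At every level the children
    (k+1, b) are coloured with K colours so that two children at distance less
    than 2 A0 delta^k have different colours ([exists_child_coloring]); by
    geometric doubling a child has boundedly many such neighbours, so K depends
    on A0, A1 and delta only.  Given a colour c, the point (k, a) moves to its
    child of colour c if it has one, and otherwise to a central child, one
    within delta^(k+1) of it.  Central children are far from all children of
    other points, and two children of colour c are far from each other, so any
    choice of one colour per level gives new dyadic points
    ([selection_new_dyadic_points]).

    The sample space is the product over the integers of uniformly distributed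
    colours, and the system t uses at level k the colour w k + t modulo K.  For
    fixed w and k, all colours occur as t runs; hence every child (k+1, b) is
    the new point of its parent in one of the K systems.  A ball of radius
    comparable to delta^(k+1) lies close to some child, so it lies in the inner
    ball of the corresponding cube of level k, which gives (i).  For fixed t,
    the colour w k + t is uniform, which gives (ii) with tau0 = 1 / K.  The
    product measure is the law of the base-K digits of a uniform random point
    of [0, 1[ ([digit_law_independent]).

    It remains to build cubes from any separated and dense family of points z
    ([exists_dyadic_system]).  A point y is approximated by points z^n_b of
    level n; along an ultrafilter in n their ancestors stabilise at every level,
    which selects one branch of the tree whose closed cubes all contain y
    ([exists_branch]).  With one branch chosen for each y, let Q^k_a be the set
    of those y whose branch passes through (k, a): disjointness, covering and
    nesting are then immediate, and the other properties follow from the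
    estimates that place the closed cubes between concentric balls. *)

(** * Topology and packing in quasi-metric spaces *)

Section Topology.
Context {R : realType} {X : Type} (rho : X -> X -> R) (A0 : R).
Hypotheses (hA0 : 1 <= A0) (qm : quasi_metric A0 rho).

Lemma qm_ge0 x y : 0 <= rho x y. Proof. by case: qm. Qed.

Lemma qm_refl x : rho x x = 0. Proof. by case: qm => _ /(_ x x)[_ ->]. Qed.

Lemma qm_sym x y : rho x y = rho y x. Proof. by case: qm. Qed.

Lemma qm_triangle y x z : rho x z <= A0 * (rho x y + rho y z).
Proof. by case: qm. Qed.

Lemma qm_triangle_lt y x z r s : rho x y < r -> rho y z < s ->
  rho x z < A0 * (r + s).
Proof.
move=> xy yz; apply: le_lt_trans (qm_triangle y x z) _.
by rewrite ltr_pM2l ?(lt_le_trans ltr01)// ltrD.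
Qed.

(** A ball need not be open, but it is still a neighbourhood of its centre: the
    points having a ball inside U form an open set, because a ball around a
    point of B(y, f / (2 A0)) of that same radius lies in B(y, f). *)
Lemma qspace_nbhsP (x : qspace rho) (U : set (qspace rho)) :
  nbhs x U <-> exists2 e : R, 0 < e & qball rho x e `<=` U.
Proof.
have A0gt0 : 0 < A0 by exact: lt_le_trans hA0.
split=> [[V [oV Vx VU]]|[e e0 eU]].
  by have [e e0 eV] := oV x Vx; exists e => // y /eV /VU.
exists [set y | exists2 f, 0 < f & qball rho y f `<=` U]; split.
- move=> y [f f0 fU].
  exists (f / (2 * A0)); first by rewrite divr_gt0 ?mulr_gt0.
  move=> u yu; exists (f / (2 * A0)); first by rewrite divr_gt0 ?mulr_gt0.
  move=> v uv; apply: fU; rewrite /qball/=.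
  apply: lt_le_trans (qm_triangle_lt uv yu) _.
  suff -> : A0 * (f / (2 * A0) + f / (2 * A0)) = f by [].
  by field; rewrite gt_eqF.
- by exists e.
- by move=> y [f f0]; apply; rewrite /qball/= qm_refl.
Qed.

Lemma qspace_closureP (S : set (qspace rho)) (y : qspace rho) :
  closure S y <-> forall e : R, 0 < e -> exists2 u, S u & rho u y < e.
Proof.
split=> [Sy e e0|Sy U /qspace_nbhsP[e e0 eU]].
  have [|u [Su uy]] := Sy (qball rho y e).
    by apply/qspace_nbhsP; exists e.
  by exists u.
by have [u Su uy] := Sy e e0; exists u; split => //; exact: eU.
Qed.

End Topology.

Section Packing.
Context {R : realType} {X : Type} (rho : X -> X -> R) (A0 : R) (A1 : nat).
Hypotheses (hA0 : 1 <= A0) (qm : quasi_metric A0 rho)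
  (gd : geometrically_doubling rho A1).

Lemma doubling_iter (j : nat) (x : X) (r : R) : 0 < r ->
  exists c : nat -> X, forall y, rho y x < r ->
    exists2 i, (i < A1 ^ j)%N & rho y (c i) < r / 2 ^+ j.
Proof.
move=> r0; elim: j => [|j [c IH]].
  by exists (fun=> x) => y yx; exists 0%N; rewrite // expr0 divr1.
have s0 : 0 < r / 2 ^+ j by rewrite divr_gt0// exprn_gt0.
have [d dP] := choice (fun i => gd (c i) s0).
exists (fun n => nth x (d (n %/ A1)%N) (n %% A1)%N) => y /IH[i iA yi].
have [szd /(_ y yi)[k yk]] := dP i.
have kA : (k < A1)%N by exact: leq_trans (ltn_ord k) szd.
have A1gt0 : (0 < A1)%N by exact: leq_ltn_trans kA.
exists (i * A1 + k)%N; first by rewrite expnSr; nia.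
rewrite divnMDl// divn_small// addn0 modnMDl modn_small//.
rewrite exprS invfM [_^-1 * _]mulrC mulrA.
by rewrite (set_nth_default (c i)).
Qed.

(** Two points of one ball of radius r / 2^j are closer than 2 A0 r / 2^j, so
    each ball of the j-fold iterated cover holds at most one of them. *)
Lemma separated_size_le (j : nat) (x : X) (r e : R) (p : nat -> X)
    (s : seq nat) :
  0 < r -> 2 * A0 * (r / 2 ^+ j) <= e -> uniq s ->
  (forall a, a \in s -> rho (p a) x < r) ->
  {in s &, forall a b, a <> b -> e <= rho (p a) (p b)} ->
  (size s <= A1 ^ j)%N.
Proof.
move=> r0 re us sx sep; have [c cP] := doubling_iter j x r0.
have cover a : exists i, a \in s ->
    (i < A1 ^ j)%N /\ rho (p a) (c i) < r / 2 ^+ j.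
  have [/sx/cP[i ij ai]|nas] := boolP (a \in s); last by exists 0%N.
  by exists i.
have [f fP] := choice cover.
rewrite -(size_map f) -(size_iota 0 (A1 ^ j)); apply: uniq_leq_size.
  rewrite map_inj_in_uniq// => a b sa sb fab; apply: contrapT => ab.
  have [[_ ac] [_ bc]] := (fP _ sa, fP _ sb).
  have := sep _ _ sa sb ab; apply/negP; rewrite -ltNge.
  apply: lt_le_trans re; rewrite -fab (qm_sym qm) in bc.
  by apply: lt_le_trans (qm_triangle_lt hA0 qm ac bc) _; lra.
by move=> _ /mapP[a sa ->]; rewrite mem_iota; have [] := fP _ sa.
Qed.

Lemma exists_halving (r e : R) : 0 < e -> exists j : nat, r / 2 ^+ j <= e.
Proof.
move=> e0; exists (Num.truncn `|r / e|).
have : r / e <= 2 ^+ Num.truncn `|r / e|.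
  apply: le_trans (ler_norm _) _; apply: ltW.
  apply: lt_le_trans (truncnS_gt _) _.
  by rewrite -natrX ler_nat ltn_expl.
by rewrite ler_pdivrMr// ler_pdivrMr ?exprn_gt0// mulrC.
Qed.

(** Labels are natural numbers, so a finite set of labels is a bounded one; this
    is the form of local finiteness used throughout. *)
Lemma separated_bounded (e : R) (S : set nat) (p : nat -> X) (x : X) (r : R) :
  0 < e -> (forall a b, S a -> S b -> a <> b -> e <= rho (p a) (p b)) ->
  exists n, forall a, S a -> rho x (p a) < r -> (a < n)%N.
Proof.
move=> e0 sep; apply: contrapT => unb.
have large n : exists a, [/\ S a, rho x (p a) < r & (n <= a)%N].
  apply: contrapT => na; apply: unb; exists n => a Sa ar.
  by rewrite ltnNge; apply/negP => an; apply: na; exists a.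
have r0 : 0 < r.
  by have [a [_ ar _]] := large 0%N; exact: le_lt_trans (qm_ge0 qm x (p a)) ar.
have [j jP] : exists j, r / 2 ^+ j <= e / (2 * A0).
  by apply: exists_halving; rewrite divr_gt0// mulr_gt0// (lt_le_trans ltr01).
(* One label more than the packing bound allows. *)
have [s [ss us sP]] : exists s : seq nat, [/\ size s = (A1 ^ j).+1, uniq s &
    forall a, a \in s -> S a /\ rho (p a) x < r].
  elim: (_ .+1) => [|n [s [ss us sP]]]; first by exists [::].
  have [a [Sa ar sa]] := large (\max_(b <- s) b.+1)%N.
  exists (a :: s); split => [|/=|b]; first by rewrite /= ss.
    rewrite us andbT; apply/negP => as_.
    by have := leq_trans (leq_bigmax_seq _ as_ isT) sa; rewrite ltnn.
  by rewrite inE => /predU1P[->|/sP//]; rewrite (qm_sym qm).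
suff : (size s <= A1 ^ j)%N by rewrite ss ltnn.
apply: (@separated_size_le j x r e p) => //.
- move: jP; rewrite ler_pdivlMr ?mulr_gt0// ?(lt_le_trans ltr01)//.
  by rewrite mulrC.
- by move=> a /sP[].
- by move=> a b /sP[Sa _] /sP[Sb _]; exact: sep.
Qed.

End Packing.

(** * Trees of labels and limits of branches *)

Section Tree.
Variables (A : int -> set nat) (parent : int -> nat -> nat -> Prop).

Lemma tree_le_level p q : tree_le A parent p q -> q.1 <= p.1.
Proof.
elim=> [r s [-> _ _ _]|r|r s t _ sr _ ts]; [lia|lia|lia].
Qed.

(** A chain from (l, b) up to (k, a) can be cut just below its top, since the
    last step goes from level k + 1 to level k. *)
Lemma tree_le_last l b k a : tree_le A parent (l, b) (k, a) ->
  (l = k /\ b = a) \/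
  exists2 c, tree_le A parent (l, b) (k + 1, c)
    & [/\ A (k + 1) c, A k a & parent k c a].
Proof.
move=> /clos_rt_rtn1_iff; move kaE : (k, a) => q lbq.
case: q / lbq kaE => [[-> ->]|[l' c] q [/= l'E Ac Aq cq] lbc qE]; first by left.
subst q; rewrite /= in l'E Aq cq; subst l'.
by right; exists c; [exact/clos_rt_rtn1_iff|split].
Qed.

Lemma tree_le_same_level k b a : tree_le A parent (k, b) (k, a) -> b = a.
Proof.
by move=> /tree_le_last[[_ ->]|[c /tree_le_level /=]]; last lia.
Qed.

Lemma tree_le_factor l b k a : tree_le A parent (l, b) (k, a) -> k < l ->
  exists2 c, tree_le A parent (l, b) (k + 1, c)
    & [/\ A (k + 1) c, A k a & parent k c a].
Proof. by move=> /tree_le_last[[->]|//]; rewrite ltxx. Qed.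

Lemma tree_le_child k b a : tree_le A parent (k + 1, b) (k, a) -> parent k b a.
Proof.
move=> /tree_le_factor[|c /tree_le_same_level -> []//].
by rewrite ltrDl.
Qed.

Lemma tree_le_step k b a : A (k + 1) b -> A k a -> parent k b a ->
  tree_le A parent (k + 1, b) (k, a).
Proof. by move=> Ab Aa ba; apply: rt_step. Qed.

Lemma tree_le_trans p q r : tree_le A parent p q -> tree_le A parent q r ->
  tree_le A parent p r.
Proof. exact: rt_trans. Qed.

Lemma le_intP (k l : int) : k <= l -> exists n : nat, l = k + n%:Z.
Proof. by move=> kl; exists `|l - k|%N; lia. Qed.

Lemma tree_le_ancestor l b k :
  (forall k b, A (k + 1) b -> exists2 a, A k a & parent k b a) ->
  A l b -> k <= l -> exists2 a, A k a & tree_le A parent (l, b) (k, a).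
Proof.
move=> par Alb /le_intP[n lE]; elim: n k lE => [|n IH] k lE.
  by exists b; [move: Alb|]; rewrite lE addr0//; exact: rt_refl.
have [|c Ac lbc] := IH (k + 1); first by lia.
have [a Aa ca] := par _ _ Ac; exists a => //.
by apply: tree_le_trans lbc _; exact: tree_le_step.
Qed.

Lemma tree_le_uniq l b k a a' :
  (forall k b a a', parent k b a -> parent k b a' -> a = a') ->
  tree_le A parent (l, b) (k, a) -> tree_le A parent (l, b) (k, a') -> a = a'.
Proof.
move=> par lba; have /le_intP[n /= lE] := tree_le_level lba.
elim: n k lE a a' lba => [|n IH] k lE a a'.
  by rewrite addr0 in lE; subst l => /tree_le_same_level <- /tree_le_same_level.
have kl : k < l by lia.
move=> /tree_le_factor/(_ kl)[c lbc [_ _ ca]].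
move=> /tree_le_factor/(_ kl)[c' lbc' [_ _ ca']].
by apply: par ca _; rewrite (IH (k + 1) _ _ _ lbc lbc')//; lia.
Qed.

End Tree.

(** An ultrafilter contains one of the parts of any finite partition of one of
    its members; this replaces the diagonal extraction in Koenig's lemma by a
    choice made at all levels at once. *)
Section Pigeonhole.
Context {T : Type} (U : set_system T) {FU : UltraFilter U}.

Lemma ultra_pigeonhole (N : nat) (G : nat -> set T) :
  U [set n | exists2 a, (a < N)%N & G a n] -> exists2 a, (a < N)%N & U (G a).
Proof.
elim: N => [|N IH] UG; first by have [n []] := @filter_ex _ _ _ _ UG.
have [UGN|UGN] := in_ultra_setVsetC (G N) FU; first by exists N.
have [|a aN Ua] := IH; last by exists a => //; exact: ltnW.
apply: filterS2 UG UGN => n [a aN Gan] nGN; exists a => //.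
by rewrite ltn_neqAle -ltnS aN andbT; apply/eqP => aE; apply: nGN; rewrite -aE.
Qed.

End Pigeonhole.

(** * Arithmetic of the constants *)

(** Since A0 >= 1, the assumption 144 A0^8 delta <= 1 gives
    144 A0^m delta <= A0^-j whenever m + j <= 8.  Each inequality below is
    reduced to instances of this by writing the constants in powers of A0. *)
Section Constants.
Context {R : realType} (A0 delta : R).
Hypotheses (hA0 : 1 <= A0) (hdelta : 0 < delta < 1)
  (hsmall : 144 * A0 ^+ 8 * delta <= 1).

Let A0gt0 : 0 < A0. Proof. exact: lt_le_trans hA0. Qed.
Let A0neq0 : A0 != 0. Proof. by rewrite gt_eqF. Qed.

Lemma power_delta_le (m j : nat) : (m + j <= 8)%N ->
  144 * (A0 ^+ m * delta) <= A0 ^- j.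
Proof.
move=> mj8; rewrite -(@ler_pM2l _ (A0 ^+ j)) ?exprn_gt0//.
rewrite divff ?expf_neq0//; apply: le_trans hsmall.
rewrite mulrCA -mulrA ler_pM2l// mulrA ler_pM2r; last by case/andP: hdelta.
by rewrite -exprD ler_weXn2l// addnC.
Qed.

Lemma c0E : cst_c0 A0 = A0 ^- 2 / 4.
Proof. by rewrite /cst_c0; field. Qed.

Lemma c1E : cst_c1 A0 = A0 ^- 4 / 12.
Proof. by rewrite /cst_c1 c0E; field. Qed.

Lemma c0_gt0 : 0 < cst_c0 A0.
Proof. by rewrite invr_gt0 mulr_gt0// exprn_gt0. Qed.

Lemma C0_gt0 : 0 < cst_C0 A0.
Proof. by rewrite mulr_gt0. Qed.

Lemma c1_gt0 : 0 < cst_c1 A0.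
Proof. by rewrite c1E divr_gt0// invr_gt0 exprn_gt0. Qed.

Lemma C1_gt0 : 0 < cst_C1 A0.
Proof. by rewrite mulr_gt0 ?mulr_gt0 ?C0_gt0. Qed.

Lemma inv_power_le (j l : nat) : (j <= l)%N -> A0 ^- l <= A0 ^- j.
Proof. by move=> jl; rewrite lef_pV2 ?posrE ?exprn_gt0// ler_weXn2l. Qed.

Lemma inv_power_ge0 (j : nat) : 0 <= A0 ^- j.
Proof. by rewrite invr_ge0 exprn_ge0// ltW. Qed.

Lemma A0_sqr_ge1 : 1 <= A0 ^+ 2. Proof. exact: exprn_ege1. Qed.

(** A close parent is in particular within the radius allowed to far parents. *)
Lemma close_cst_le_C0 : (2 * A0)^-1 * cst_c0 A0 <= cst_C0 A0.
Proof.
have -> : (2 * A0)^-1 * cst_c0 A0 = A0 ^- 3 / 8 by rewrite c0E; field.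
by have := @inv_power_le 0 3 isT; have := hA0; rewrite expr0 invr1 /cst_C0; lra.
Qed.

Lemma c0_le_C0 : cst_c0 A0 <= cst_C0 A0.
Proof.
have := @inv_power_le 0 2 isT; have := hA0.
by rewrite expr0 invr1 c0E /cst_C0; lra.
Qed.

Lemma delta_le_C1 : delta <= cst_C1 A0.
Proof.
have -> : cst_C1 A0 = 4 * A0 ^+ 2 by rewrite /cst_C1 /cst_C0; ring.
by case/andP: hdelta; have := A0_sqr_ge1; lra.
Qed.

(** Nesting of the outer balls: distance C1 delta^(k+1) in the child ball, then
    C0 delta^k to the parent. *)
Lemma child_ball_cst : A0 * (cst_C1 A0 * delta + cst_C0 A0) <= cst_C1 A0.
Proof.
have -> : A0 * (cst_C1 A0 * delta + cst_C0 A0) =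
    4 * (A0 ^+ 3 * delta) + 2 * A0 ^+ 2 by rewrite /cst_C1 /cst_C0; ring.
have -> : cst_C1 A0 = 4 * A0 ^+ 2 by rewrite /cst_C1 /cst_C0; ring.
have := @power_delta_le 3 0 isT; rewrite expr0 invr1.
by have := A0_sqr_ge1; lra.
Qed.

(** A point of a closed cube of level k: delta^(k+1) to a point of the tree,
    C1 delta^(k+1) to its ancestor of level k + 1, then C0 delta^k. *)
Lemma closure_ball_cst :
  A0 * (A0 * (delta + cst_C1 A0 * delta) + cst_C0 A0) <= cst_C1 A0.
Proof.
have -> : A0 * (A0 * (delta + cst_C1 A0 * delta) + cst_C0 A0) =
    A0 ^+ 2 * delta + 4 * (A0 ^+ 4 * delta) + 2 * A0 ^+ 2.
  by rewrite /cst_C1 /cst_C0; ring.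
have -> : cst_C1 A0 = 4 * A0 ^+ 2 by rewrite /cst_C1 /cst_C0; ring.
have := @power_delta_le 2 0 isT; have := @power_delta_le 4 0 isT.
by rewrite expr0 invr1; have := A0_sqr_ge1; lra.
Qed.

(** The same path, ended by c1 delta^k instead, stays below the distance that
    decides a close parent. *)
Lemma inner_ball_cst :
  A0 * (A0 * (delta + cst_C1 A0 * delta) + cst_c1 A0)
    <= (2 * A0)^-1 * cst_c0 A0.
Proof.
have -> : A0 * (A0 * (delta + cst_C1 A0 * delta) + cst_c1 A0) =
    A0 ^+ 2 * delta + 4 * (A0 ^+ 4 * delta) + A0 ^- 3 / 12.
  by rewrite c1E /cst_C1 /cst_C0; field.
have -> : (2 * A0)^-1 * cst_c0 A0 = A0 ^- 3 / 8 by rewrite c0E; field.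
have := @power_delta_le 2 3 isT; have := @power_delta_le 4 3 isT.
by have := inv_power_ge0 3; lra.
Qed.

Lemma inner_point_cst : A0 * (delta + cst_c1 A0) <= cst_c0 A0.
Proof.
have -> : A0 * (delta + cst_c1 A0) = A0 ^+ 1 * delta + A0 ^- 3 / 12.
  by rewrite c1E; field.
rewrite c0E; have := @power_delta_le 1 2 isT; have := @inv_power_le 2 3 isT.
by have := inv_power_ge0 2; lra.
Qed.

(** A ball of radius delta^(k+1) around a point within delta^(k+1) of z fits in
    the inner ball around z. *)
Lemma small_ball_cst : A0 * (delta + delta) <= cst_c1 A0.
Proof.
rewrite c1E; have := @power_delta_le 1 4 isT; have := inv_power_ge0 4.
by rewrite expr1; lra.
Qed.

(** A child of another point that is within c0 delta^k of a central child would
    be within (2 A0)^-1 delta^k of the wrong parent. *)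
Lemma central_child_cst : A0 * (cst_c0 A0 + delta) <= (2 * A0)^-1.
Proof.
have -> : A0 * (cst_c0 A0 + delta) = A0 ^- 1 / 4 + A0 ^+ 1 * delta.
  by rewrite c0E; field.
have -> : (2 * A0)^-1 = A0 ^- 1 / 2 by field.
have := @power_delta_le 1 1 isT.
by have := inv_power_ge0 1; lra.
Qed.

Lemma delta_le_inv : delta <= (2 * A0)^-1.
Proof.
have -> : (2 * A0)^-1 = A0 ^- 1 / 2 by field.
have := @power_delta_le 0 1 isT; rewrite expr0 mul1r.
by have := inv_power_ge0 1; lra.
Qed.

End Constants.

(** * The scales delta^k *)

Section Scales.
Context {R : realType} (delta : R).
Hypothesis hdelta : 0 < delta < 1.

Let delta_gt0 : 0 < delta. Proof. by case/andP: hdelta. Qed.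

Lemma scale_gt0 (k : int) : 0 < delta ^ k.
Proof. exact: exprz_gt0. Qed.

Lemma scaleS (k : int) : delta ^ (k + 1) = delta * delta ^ k.
Proof. by rewrite expfzDr ?gt_eqF// expr1z mulrC. Qed.

Lemma scale_le (k l : int) : k <= l -> delta ^ l <= delta ^ k.
Proof.
move=> /le_intP[n ->]; rewrite expfzDr ?gt_eqF// -exprnP.
rewrite ger_pMr ?scale_gt0// exprn_ile1//; first exact: ltW.
by case/andP: hdelta => _ /ltW.
Qed.

Lemma scale_cvg0 (e : R) : 0 < e -> \forall n \near \oo, delta ^ (n%:Z) < e.
Proof.
move=> e0; have /cvgr0_norm_lt/(_ e e0) : (fun n => delta ^+ n) @ \oo --> 0.
  by apply: cvg_expr; rewrite gtr0_norm//; case/andP: hdelta.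
by apply: filterS => n; rewrite normrX gtr0_norm// -exprnP.
Qed.

End Scales.


Lemma exists_scale {R : realType} (delta r : R) : 0 < delta < 1 -> 0 < r ->
  exists k : int, delta ^ (k + 1) <= r <= delta ^ k.
Proof.
move=> hdelta r0; have rV0 : 0 < r^-1 by rewrite invr_gt0.
have [m _ mP] := scale_cvg0 hdelta rV0.
have [n _ nP] := scale_cvg0 hdelta r0.
have below : exists i : nat, delta ^ (- m%:Z + i%:Z + 1) <= r.
  exists (m + n)%N; apply: ltW; apply: le_lt_trans (nP n (leqnn n)).
  by apply: scale_le => //; lia.
case: (ex_minnP below) => i ir imin; exists (- m%:Z + i%:Z); rewrite ir/=.
case: i ir imin => [_ _|i _ imin].
  rewrite addr0 -exprz_inv -[r]invrK exprz_inv -invr_expz.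
  rewrite lef_pV2 ?posrE ?scale_gt0//.
  exact: ltW (mP m (leqnn m)).
rewrite leNgt; apply/negP => small; suff : (i.+1 <= i)%N by rewrite ltnn.
apply: imin; apply: ltW; move: small.
by rewrite (_ : - m%:Z + i.+1%:Z = - m%:Z + i%:Z + 1)//; lia.
Qed.

(** * Dyadic cubes from separated and dense points *)

Section Cubes.
Context {R : realType} {X : Type} (rho : X -> X -> R) (A0 delta : R) (A1 : nat).
Hypotheses (hA0 : 1 <= A0) (hdelta : 0 < delta < 1)
  (hsmall : 144 * A0 ^+ 8 * delta <= 1).
Hypotheses (qm : quasi_metric A0 rho) (gd : geometrically_doubling rho A1).
Variables (A : int -> set nat) (z : int -> nat -> X).
Hypothesis z_sep : forall k a b, A k a -> A k b -> a <> b ->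
  cst_c0 A0 * delta ^ k <= rho (z k a) (z k b).
Hypothesis z_dense : forall k y,
  exists2 a, A k a & rho y (z k a) < cst_C0 A0 * delta ^ k.

Let A0gt0 : 0 < A0. Proof. exact: lt_le_trans hA0. Qed.
Let dk_gt0 k : 0 < delta ^ k. Proof. exact: scale_gt0. Qed.

Local Notation npar := (new_parent rho A0 delta A z).
Local Notation ntree := (tree_le A npar).
Local Notation hat := (@hat_cube _ _ rho A0 delta A z).
Local Notation bar := (@bar_cube _ _ rho A0 delta A z).
Local Notation tilde := (@tilde_cube _ _ rho A0 delta A z).

Lemma z_eq_of_close k a b : A k a -> A k b ->
  rho (z k a) (z k b) < cst_c0 A0 * delta ^ k -> a = b.
Proof.
move=> Aa Ab ab; apply: contrapT => /(z_sep Aa Ab); apply/negP.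
by rewrite -ltNge.
Qed.

Lemma close_parent_uniq k b a a' : close_parent rho A0 delta A z k b a ->
  close_parent rho A0 delta A z k b a' -> a = a'.
Proof.
move=> [Aa ba] [Aa' ba']; apply: (z_eq_of_close Aa Aa').
rewrite (qm_sym qm) in ba; apply: lt_le_trans (qm_triangle_lt hA0 qm ba ba') _.
suff -> : forall c d : R, A0 * ((2 * A0)^-1 * c * d + (2 * A0)^-1 * c * d)
  = c * d by [].
by move=> c d; field; rewrite gt_eqF.
Qed.

Lemma new_parent_ex k b : A (k + 1) b -> exists2 a, A k a & npar k b a.
Proof.
move=> Ab; have [[a ba]|nclose] :=
    pselect (exists a, close_parent rho A0 delta A z k b a).
  by exists a; [case: ba|left].
have far : exists a, `[< far_parent rho A0 delta A z k b a >].
  by have [a Aa ba] := z_dense k (z (k + 1) b); exists a; exact/asboolP.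
case: (ex_minnP far) => m /asboolP mfar mmin.
exists m; first by case: mfar.
by right; split => // a' /asboolP; exact: mmin.
Qed.

Lemma new_parent_uniq k b a a' : npar k b a -> npar k b a' -> a = a'.
Proof.
move=> [ba|[nba ba amin]] [ba'|[nba' ba' amin']].
- exact: close_parent_uniq ba ba'.
- by case: nba'; exists a.
- by case: nba; exists a'.
- by apply/eqP; rewrite eqn_leq amin// amin'.
Qed.

Lemma new_parent_lt k b a : npar k b a ->
  rho (z (k + 1) b) (z k a) < cst_C0 A0 * delta ^ k.
Proof.
move=> [[_ ba]|[_ [] //]]; apply: lt_le_trans ba _.
by rewrite ler_pM2r// close_cst_le_C0.
Qed.

Lemma child_ball_sub k b a : npar k b a ->
  ball_of_cube rho A0 delta z (k + 1) b `<=` ball_of_cube rho A0 delta z k a.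
Proof.
move=> /new_parent_lt ba y yb; rewrite /ball_of_cube /qball/= in yb *.
apply: lt_le_trans (qm_triangle_lt hA0 qm yb ba) _.
rewrite scaleS// mulrA -mulrDl mulrA ler_pM2r//.
exact: child_ball_cst.
Qed.

Lemma tree_ball_sub l b k a : ntree (l, b) (k, a) ->
  ball_of_cube rho A0 delta z l b `<=` ball_of_cube rho A0 delta z k a.
Proof.
move=> lba; suff : forall p q, ntree p q -> ball_of_cube rho A0 delta z p.1 p.2
    `<=` ball_of_cube rho A0 delta z q.1 q.2 by move=> /(_ _ _ lba).
move=> p q; elim=> [r s [-> _ _ rs]|r|r s t _ rs _ st].
- exact: child_ball_sub.
- exact: subset_refl.
- exact: subset_trans st.
Qed.

(** Nesting of the outer balls along the tree bounds all descendants at once,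
    with no geometric series. *)
Lemma tree_lt l b k a : ntree (l, b) (k, a) ->
  rho (z l b) (z k a) < cst_C1 A0 * delta ^ k.
Proof.
move=> /tree_ball_sub; apply; rewrite /ball_of_cube /qball/= (qm_refl qm).
by rewrite mulr_gt0// C1_gt0.
Qed.

(** A point of a closed cube is approximated to within delta^(k+1) by a point of
    the tree, and only the ancestor of level k + 1 of the latter matters; going
    through it is what keeps the constant down to C1 in
    [bar_cube_sub_ball]. *)
Lemma bar_cubeP k a (y : X) : bar k a y ->
  rho (z k a) y < delta * delta ^ k \/
  exists c, [/\ A (k + 1) c, npar k c a &
    rho y (z (k + 1) c) < A0 * (delta + cst_C1 A0 * delta) * delta ^ k].
Proof.
have e0 : 0 < delta * delta ^ k by rewrite -scaleS.
move=> /(qspace_closureP hA0 qm)/(_ _ e0)[_ [l [b [Ab lba ->]]] lby].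
have [[lk ba]|[c lbc [Ac Aa ca]]] := tree_le_last lba; first by left; subst.
right; exists c; split => //; rewrite (qm_sym qm) in lby.
apply: lt_le_trans (qm_triangle_lt hA0 qm lby (tree_lt lbc)) _.
by rewrite scaleS// mulrA -mulrDl mulrA.
Qed.

Lemma bar_cube_sub_ball k a : bar k a `<=` ball_of_cube rho A0 delta z k a.
Proof.
move=> y /bar_cubeP[ya|[c [Ac ca yc]]]; rewrite /ball_of_cube /qball/=.
  rewrite (qm_sym qm); apply: lt_le_trans ya _; rewrite ler_pM2r//.
  exact: delta_le_C1.
apply: lt_le_trans (qm_triangle_lt hA0 qm yc (new_parent_lt ca)) _.
by rewrite -mulrDl mulrA ler_pM2r// closure_ball_cst.
Qed.

Lemma bar_cube_isolated k a b (y : X) : A k a -> A k b ->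
  rho y (z k a) < cst_c1 A0 * delta ^ k -> bar k b y -> b = a.
Proof.
move=> Aa Ab ya /bar_cubeP[yb|[c [Ac cb yc]]].
  apply: (z_eq_of_close Ab Aa).
  apply: lt_le_trans (qm_triangle_lt hA0 qm yb ya) _.
  by rewrite -mulrDl mulrA ler_pM2r// inner_point_cst.
apply: new_parent_uniq cb _; left; split => //.
rewrite (qm_sym qm) in yc; apply: lt_le_trans (qm_triangle_lt hA0 qm yc ya) _.
by rewrite -mulrDl mulrA ler_pM2r// inner_ball_cst.
Qed.

Lemma inner_ball_sub_tilde k a : A k a ->
  qball rho (z k a) (cst_c1 A0 * delta ^ k) `<=` tilde k a.
Proof.
move=> Aa y ya [b [/= Ab ba] yb]; apply: ba.
exact: bar_cube_isolated Aa Ab ya yb.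
Qed.

Lemma labels_near_bounded k (y : X) (r : R) :
  exists n, forall a, A k a -> rho y (z k a) < r -> (a < n)%N.
Proof.
apply: (separated_bounded hA0 qm gd (e := cst_c0 A0 * delta ^ k)).
  by rewrite mulr_gt0// c0_gt0.
exact: z_sep.
Qed.

(** A union of closed cubes of one level is closed because only boundedly many
    labels belong to cubes that meet a given ball. *)
Lemma tilde_cube_open k a : open (tilde k a).
Proof.
rewrite openE => y ytilde; rewrite /interior.
have [n nP] := labels_near_bounded k y (A0 * (1 + cst_C1 A0 * delta ^ k)).
have near1 : nbhs y (qball rho y 1) by apply/(qspace_nbhsP hA0 qm); exists 1.
have avoid m : nbhs y
    [set u | forall b, (b < m)%N -> A k b -> b <> a -> ~ bar k b u].
  elim: m => [|m IH]; first by apply: filterS filterT => u _ b.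
  have [[Am ma]|mm] := pselect (A k m /\ m <> a); last first.
    apply: filterS IH => u avoidu b; rewrite ltnS leq_eqVlt => /predU1P[->|].
      by move=> Am ma; case: mm.
    exact: avoidu.
  have : nbhs y (~` bar k m).
    apply: open_nbhs_nbhs; split; first exact/closed_openC/closed_closure.
    by move=> ym; apply: ytilde; exists m.
  apply: filterS2 IH => u avoidu um b.
  rewrite ltnS leq_eqVlt => /predU1P[->//|].
  exact: avoidu.
apply: filterS2 near1 (avoid n) => u uy avoidu [b [/= Ab ba] ub].
apply: (avoidu b _ Ab ba ub); apply: nP => //.
have /= ubz := bar_cube_sub_ball ub.
rewrite /qball/= (qm_sym qm) in uy.
exact: qm_triangle_lt uy ubz.
Qed.

(** An address of y in the tree.  Fixing one address for each point decides at
    all levels at once to which cube a boundary point belongs. *)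
Definition is_branch (y : X) (c : int -> nat) : Prop :=
  forall k, [/\ A k (c k), npar k (c (k + 1)) (c k) & bar k (c k) y].

Lemma branch_tree y c k l : is_branch y c -> k <= l -> ntree (l, c l) (k, c k).
Proof.
move=> yc /le_intP[n ->]; elim: n => [|n IH].
  by rewrite addr0; exact: rt_refl.
apply: tree_le_trans IH; rewrite -addn1 PoszD addrA; apply: tree_le_step.
- by case: (yc (k + n%:Z + 1)).
- by case: (yc (k + n%:Z)).
- by case: (yc (k + n%:Z)).
Qed.

(** The points z^n_{b n} converge to y.  Their ancestors at a fixed level k stay
    within a bounded distance of y, so they range over finitely many labels and
    are constant on a member of a fixed free ultrafilter U.  Two members of U
    meet, so the limits at levels k and k + 1 are related by the tree; and
    every member of U contains arbitrarily large n, so y is a limit of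
    descendants of the chosen label. *)
Lemma exists_branch (y : X) : exists c, is_branch y c.
Proof.
have approx (n : nat) : exists a,
    A n a /\ rho y (z n a) < cst_C0 A0 * delta ^ n.
  by have [a] := z_dense n y; exists a.
have [b bP] := choice approx.
have [U [FU leU]] := ultraFilterLemma eventually_filter.
pose G k n := [set a | A k a /\ ntree (n%:Z, b n) (k, a)].
have large k : \forall n \near \oo, k <= n%:Z.
  by exists `|k|%N => // n /=; lia.
have limit k : exists a, U [set n | G k n a].
  have [N NP] := labels_near_bounded k y
    (A0 * (cst_C0 A0 * delta ^ k + cst_C1 A0 * delta ^ k)).
  suff : U [set n | exists2 a, (a < N)%N & G k n a].
    by move=> /ultra_pigeonhole[a _ Ua]; exists a.
  apply: leU; apply: filterS (large k) => n kn.
  have [Ab yb] := bP n; have [a Aa ba] := tree_le_ancestor new_parent_ex Ab kn.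
  exists a => //; apply: NP => //.
  apply: lt_le_trans (qm_triangle_lt hA0 qm yb (tree_lt ba)) _.
  by rewrite ler_pM2l// lerD2r ler_pM2l ?C0_gt0// scale_le.
have [c cP] := choice limit.
exists c => k.
have UGG : U ([set n | G k n (c k)] `&` [set n | G (k + 1) n (c (k + 1))]).
  exact: filterI.
have [n [[Ack nk] [Ack1 nk1]]] := filter_ex UGG.
split => //.
  have kn : k < n%:Z by have /= := tree_le_level nk1; lia.
  have [a na [_ _ ak]] := tree_le_factor nk kn.
  by rewrite (tree_le_uniq new_parent_uniq nk1 na).
apply/(qspace_closureP hA0 qm) => e e0.
have Ue := leU _ (scale_cvg0 hdelta (divr_gt0 e0 (C0_gt0 hA0))).
have UGe : U ([set n | G k n (c k)] `&`
    [set n | delta ^ n%:Z < e / cst_C0 A0]) by exact: filterI.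
have [m [[_ mk] me]] := filter_ex UGe.
have [Ab yb] := bP m; exists (z m%:Z (b m)); first by exists m%:Z, (b m).
rewrite (qm_sym qm); apply: lt_trans yb _.
by move: me; rewrite /= ltr_pdivlMr ?C0_gt0// mulrC.
Qed.

(** The open cube at (k, a) meets no other closed cube of level k, so the branch
    of each of its points passes through (k, a).  In particular z^l_b, the
    centre of an inner ball, lies in its own Q^l_b; hence Q^k_a contains the
    descendants of (k, a), and its closure is the closed cube.  A neighbourhood
    of a point of another closed cube of level k contains descendants of the
    other label, which lie in a disjoint cube, so the interior of Q^k_a is the
    open cube. *)
Lemma exists_dyadic_system : exists Q : int -> nat -> set (qspace rho),
  dyadic_system rho A0 delta A z Q /\ dyadic_properties rho A0 delta A z Q.
Proof.
have [c cP] := choice exists_branch.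
pose Q k a : set (qspace rho) := [set y | c y k = a].
have Q_sub_bar k a : Q k a `<=` bar k a.
  by move=> y <-; case: (cP y k).
have tilde_sub_Q k a : tilde k a `<=` Q k a.
  move=> y ytilde; apply: contrapT => ya; apply: ytilde.
  by case: (cP y k) => Ac _ yc; exists (c y k).
have z_mem l b : A l b -> Q l b (z l b).
  move=> Alb; apply/tilde_sub_Q/inner_ball_sub_tilde => //.
  by rewrite /qball/= (qm_refl qm) mulr_gt0// c1_gt0.
have Q_tree k l a b : ntree (l, b) (k, a) -> Q l b `<=` Q k a.
  move=> ba y yb; have := branch_tree (cP y) (tree_le_level ba).
  by rewrite yb => /(tree_le_uniq new_parent_uniq ba).
have hat_sub_Q k a : hat k a `<=` Q k a.
  by move=> _ [l [b [Ab ba ->]]]; apply: (Q_tree _ _ _ _ ba); exact: z_mem.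
have Q_nested k l a b : A k a -> A l b -> k <= l ->
    Q l b `<=` Q k a \/ Q k a `&` Q l b = set0.
  move=> Aa Ab kl; have [ba|nba] := pselect (ntree (l, b) (k, a)).
    by left; exact: Q_tree.
  right; apply/seteqP; split=> // y [ya yb]; apply: nba.
  by rewrite -ya -yb; exact: branch_tree (cP y) kl.
exists Q; split; first by move=> k a _.
split => //.
- move=> k a Aa; split; apply/seteqP; split.
  + move=> y yQ [b [/= Ab ba] yb]; have [u [ub ua]] := yb _ yQ; apply: ba.
    by have := hat_sub_Q _ _ _ ub; rewrite -[RHS]ua.
  + by rewrite -open_subsetE; [exact: tilde_sub_Q|exact: tilde_cube_open].
  + move=> y /(closureS (Q_sub_bar k a)).
    by rewrite -(closure_id _).1//; exact: closed_closure.
  + exact/closureS/hat_sub_Q.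
- move=> k; split.
    by apply/seteqP; split=> // y _; case: (cP y k) => Ac _ _; exists (c y k).
  by move=> a b _ _ [y [<- <-]].
- move=> k a Aa; split.
    by move=> y /(inner_ball_sub_tilde Aa); exact: tilde_sub_Q.
  by move=> y /Q_sub_bar; exact: bar_cube_sub_ball.
- move=> k l a b Aa Ab kl ba; apply: tree_ball_sub.
  have := branch_tree (cP (z l b)) kl.
  by rewrite (z_mem _ _ Ab) (ba _ (z_mem _ _ Ab)).
Qed.

End Cubes.

Lemma attained_min_ltP {R : realType} (S : set nat) (f : nat -> R) (c : R)
    (n : nat) :
  (exists2 a, S a & f a < c) -> (forall a, S a -> f a < c -> (a < n)%N) ->
  attained_min_lt S f c.
Proof.
move=> [a Sa ac] bnd; pose i0 := Ordinal (bnd a Sa ac).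
have Pi0 : `[< S i0 >] by exact/asboolP.
case: (@arg_minP _ _ _ i0 (fun i : 'I_n => `[< S i >]) (fun i => f i) Pi0).
move=> i /asboolP Si imin.
have ic : f i < c by exact: le_lt_trans (imin i0 Pi0) ac.
exists i; split => // b Sb; have [bc|cb] := ltP (f b) c.
  by apply: (imin (Ordinal (bnd b Sb bc))); exact/asboolP.
exact: le_trans (ltW ic) cb.
Qed.

(** * New dyadic points from coloured children *)

Section GreedyColoring.
Variables (e : nat -> nat -> Prop) (N : nat).
Hypothesis earlier_le : forall n (s : seq nat), uniq s ->
  (forall m, m \in s -> (m < n)%N /\ e m n) -> (size s <= N)%N.

Let free_color (p : nat * (nat -> 'I_N.+1)) :
  exists c, forall m, (m < p.1)%N -> e m p.1 -> p.2 m <> c.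
Proof.
case: p => n col /=.
apply: contrapT => nofree.
have used c : exists m, [/\ (m < n)%N, e m n & col m = c].
  apply: contrapT => nc; apply: nofree; exists c => m mn emn mc.
  by apply: nc; exists m.
have [g gP] := choice used.
have : (size (map g (enum 'I_N.+1)) <= N)%N.
  apply: (earlier_le (n := n)).
    rewrite map_inj_uniq ?enum_uniq// => c d cd.
    by case: (gP c) => _ _ <-; case: (gP d) => _ _ <-; rewrite cd.
  by move=> _ /mapP[c _ ->]; case: (gP c).
by rewrite size_map size_enum_ord ltnn.
Qed.

Lemma greedy_coloring : exists col : nat -> 'I_N.+1,
  forall m n, (m < n)%N -> e m n -> col m <> col n.
Proof.
have [ext extP] := choice free_color.
(* [pre n] holds the final colours of all labels below n. *)
pose fix pre n : nat -> 'I_N.+1 := if n is n'.+1 then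
  fun m => if m == n' then ext (n', pre n') else pre n' m else fun=> ord0.
have pre_stable n m : (m < n)%N -> pre n m = pre m.+1 m.
  elim: n => // n IH; rewrite ltnS leq_eqVlt => /predU1P[->//|mn] /=.
  by rewrite eqxx ltn_eqF// IH//= eqxx.
exists (fun n => pre n.+1 n) => m n mn emn.
by rewrite -(pre_stable _ _ mn) /= eqxx; exact: (extP (n, pre n)).
Qed.

End GreedyColoring.

Section NewPoints.
Context {R : realType} {X : Type} (rho : X -> X -> R) (A0 delta : R) (A1 : nat).
Hypotheses (hA0 : 1 <= A0) (hdelta : 0 < delta < 1)
  (hsmall : 144 * A0 ^+ 8 * delta <= 1).
Hypotheses (qm : quasi_metric A0 rho) (gd : geometrically_doubling rho A1).
Variables (A : int -> set nat) (x : int -> nat -> X)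
  (parent : int -> nat -> nat -> Prop).
Hypotheses (refx : reference_points rho delta A x)
  (refp : reference_parent rho A0 delta A x parent).

Let A0gt0 : 0 < A0. Proof. exact: lt_le_trans hA0. Qed.
Let dk_gt0 k : 0 < delta ^ k. Proof. exact: scale_gt0. Qed.

Definition separating (K : nat) (k : int) (col : nat -> 'I_K) : Prop :=
  forall b b', A (k + 1) b -> A (k + 1) b' -> b <> b' ->
    rho (x (k + 1) b) (x (k + 1) b') < 2 * A0 * delta ^ k -> col b <> col b'.

(** The exponent j is such that a ball of radius 2 A0 delta^k holds at most
    A1^j points separated by delta^(k+1). *)
Lemma exists_child_coloring (j : nat) (k : int) :
  2 * A0 * (2 * A0) / 2 ^+ j <= delta ->
  exists col : nat -> 'I_(A1 ^ j).+1, separating k col.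
Proof.
move=> hj; have [sep _] := refx.
pose e m n := [/\ A (k + 1) m, A (k + 1) n &
  rho (x (k + 1) m) (x (k + 1) n) < 2 * A0 * delta ^ k].
have [|col colP] := @greedy_coloring e (A1 ^ j).
  move=> n s us sP; have r0 : 0 < 2 * A0 * delta ^ k by rewrite !mulr_gt0.
  apply: (@separated_size_le _ _ _ _ _ hA0 qm gd j (x (k + 1) n) _
    (delta ^ (k + 1)) (x (k + 1)) s r0 _ us).
  - rewrite scaleS// [2 * A0 * delta ^ k / _]mulrAC mulrA ler_pM2r//.
    by rewrite mulrA.
  - by move=> a /sP[_ []].
  - by move=> a b /sP[_ [Aa _ _]] /sP[_ [Ab _ _]]; exact: sep.
exists col => b b' Ab Ab' bb' near.
have [lt|lt|//] := ltngtP b b'; first exact: colP.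
by apply/nesym/colP => //; split => //; rewrite (qm_sym qm).
Qed.

(** By density some child lies within delta^(k+1) of its parent; it is a child
    because delta^(k+1) <= (2 A0)^-1 delta^k. *)
Lemma central_child_ex k a : A k a -> exists b, [/\ A (k + 1) b, parent k b a &
  rho (x (k + 1) b) (x k a) < delta ^ (k + 1)].
Proof.
move=> Aa; have [b [Ab _ ab]] := refx.2 (k + 1) (x k a).
have [_ close _] := refp; rewrite (qm_sym qm) in ab.
exists b; split => //; apply: close => //; apply: lt_le_trans ab _.
by rewrite scaleS// ler_pM2r//; exact: delta_le_inv.
Qed.

Lemma child_lt k b a : A k a -> A (k + 1) b -> parent k b a ->
  rho (x (k + 1) b) (x k a) < delta ^ k.
Proof. by have [_ _ h] := refp; exact: h. Qed.

Lemma sibling_lt k b b' a : A k a -> A (k + 1) b -> A (k + 1) b' ->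
  parent k b a -> parent k b' a ->
  rho (x (k + 1) b) (x (k + 1) b') < 2 * A0 * delta ^ k.
Proof.
move=> Aa Ab Ab' ba b'a; have b'a' := child_lt Aa Ab' b'a.
rewrite (qm_sym qm) in b'a'.
by apply: lt_le_trans (qm_triangle_lt hA0 qm (child_lt Aa Ab ba) b'a') _; lra.
Qed.

Lemma central_child_isolated k a a' b b' : A k a -> A k a' -> a <> a' ->
  A (k + 1) b -> parent k b a -> A (k + 1) b' -> parent k b' a' ->
  rho (x (k + 1) b) (x k a) < delta ^ (k + 1) ->
  cst_c0 A0 * delta ^ k <= rho (x (k + 1) b) (x (k + 1) b').
Proof.
move=> Aa Aa' aa' Ab ba Ab' ba' central; rewrite leNgt; apply/negP => close.
have [uniq_parent is_parent _] := refp; apply: aa'.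
have [p [_ pP]] := uniq_parent k b' Ab'.
rewrite -(pP a') ?(pP a)//; split => //; apply: is_parent => //.
rewrite (qm_sym qm) in close.
apply: lt_le_trans (qm_triangle_lt hA0 qm close central) _.
by rewrite scaleS// -mulrDl mulrA ler_pM2r// central_child_cst.
Qed.

Definition colored_selection (K : nat) (k : int) (col : nat -> 'I_K)
    (sel : 'I_K * nat -> nat) : Prop :=
  forall c a, A k a ->
    [/\ A (k + 1) (sel (c, a)), parent k (sel (c, a)) a,
        col (sel (c, a)) = c \/
          rho (x (k + 1) (sel (c, a))) (x k a) < delta ^ (k + 1)
      & forall b, A (k + 1) b -> parent k b a -> col b = c -> sel (c, a) = b].

(** Siblings are closer than 2 A0 delta^k, so a point has at most one child of a
    given colour. *)
Lemma exists_colored_selection (K : nat) (k : int) (col : nat -> 'I_K) :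
  separating k col -> exists sel, colored_selection k col sel.
Proof.
move=> sep; have pick (ca : 'I_K * nat) : exists b, A k ca.2 ->
    [/\ A (k + 1) b, parent k b ca.2,
        col b = ca.1 \/ rho (x (k + 1) b) (x k ca.2) < delta ^ (k + 1)
      & forall b', A (k + 1) b' -> parent k b' ca.2 -> col b' = ca.1 -> b = b'].
  case: ca => c a /=.
  have [[b [Ab ba bc]]|nc] :=
      pselect (exists b, [/\ A (k + 1) b, parent k b a & col b = c]).
    exists b => Aa; split => // [|b' Ab' b'a b'c]; first by left.
    apply: contrapT => bb'; have := sibling_lt Aa Ab Ab' ba b'a.
    by move=> /(sep _ _ Ab Ab' bb'); rewrite bc b'c.
  have [Aa|nAa] := pselect (A k a); last by exists 0%N.
  have [b [Ab ba central]] := central_child_ex Aa.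
  exists b => _; split => // [|b' Ab' b'a b'c]; first by right.
  by case: nc; exists b'.
have [sel selP] := choice pick; exists sel => c a Aa.
exact: (selP (c, a)).
Qed.

(** The colour t k of each level is arbitrary and levels do not interact, which
    is what makes independent random colours possible. *)
Lemma selection_new_dyadic_points (K : nat) (col : int -> nat -> 'I_K)
    (sel : int -> 'I_K * nat -> nat) (t : int -> 'I_K) :
  (forall k, separating k (col k)) ->
  (forall k, colored_selection k (col k) (sel k)) ->
  new_dyadic_points rho A0 delta A x parent
    (fun k a => x (k + 1) (sel k (t k, a))).
Proof.
move=> sep selP; have [uniq_parent _ _] := refp.
have z_sep k a b : A k a -> A k b -> a <> b -> cst_c0 A0 * delta ^ k <=
    rho (x (k + 1) (sel k (t k, a))) (x (k + 1) (sel k (t k, b))).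
  move=> Aa Ab ab.
  have [As sa ca _] := selP k (t k) a Aa.
  have [As' sb cb _] := selP k (t k) b Ab.
  case: ca => [ca|central]; last first.
    exact: central_child_isolated Aa Ab ab _ _ _ _ _.
  case: cb => [cb|central]; last first.
    rewrite (qm_sym qm).
    exact: central_child_isolated Ab Aa (nesym ab) _ _ _ _ _.
  rewrite leNgt; apply/negP => close.
  apply: (sep k _ _ As As'); last by rewrite ca cb.
  - move=> ss'; apply: ab; rewrite -ss' in sb.
    by have [p [_ pP]] := uniq_parent _ _ As; rewrite -(pP a) ?(pP b).
  - by apply: lt_le_trans close _; rewrite ler_pM2r//; exact: c0_le_C0.
split => [k a Aa|//|k y].
  have [As sa _ _] := selP k (t k) a Aa; exists (sel k (t k, a)); split => //.
  exact: tree_le_step.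
have [n nP] := separated_bounded hA0 qm gd y (cst_C0 A0 * delta ^ k)
  (mulr_gt0 (c0_gt0 hA0) (dk_gt0 k)) (z_sep k).
apply: attained_min_ltP nP.
have [a [Aa _ ya]] := refx.2 k y; exists a => //.
have [As sa _ _] := selP k (t k) a Aa.
have := child_lt Aa As sa; rewrite (qm_sym qm) => as_.
apply: lt_le_trans (qm_triangle_lt hA0 qm ya as_) _.
by rewrite /cst_C0; lra.
Qed.

End NewPoints.

(** * Independent uniform letters from the digits of a real number *)

HB.instance Definition _ n := isPointed.Build 'I_n.+1 ord0.
HB.instance Definition _ n := @isMeasurable.Build default_measure_display
  'I_n.+1 discrete_measurable discrete_measurable0
  discrete_measurableC discrete_measurableU.

Section Digits.
Context {R : realType} (N : nat).
Local Notation b := (N.+1).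
Implicit Types (x : R) (E : nat -> set 'I_b).

(** The first n base-b digits of x, read as one natural number. *)
Definition digit_prefix (n : nat) (x : R) : nat := Num.truncn (b%:R ^+ n * x).

Definition digit (n : nat) (x : R) : 'I_b := inord (digit_prefix n.+1 x %% b).

Let pow_gt0 n : 0 < b%:R ^+ n :> R. Proof. exact: exprn_gt0. Qed.

Lemma digit_prefixS n x : 0 <= x ->
  digit_prefix n x = (digit_prefix n.+1 x %/ b)%N.
Proof.
move=> x0; apply: truncn_def; set m := digit_prefix n.+1 x.
have /truncn_itv/andP[] : 0 <= b%:R ^+ n.+1 * x by rewrite mulr_ge0// ltW.
rewrite -/(digit_prefix _ _) -/m => mx xm.
rewrite exprS -mulrA in mx xm; apply/andP; split.
  rewrite -(@ler_pM2l _ b%:R)// -natrM; apply: le_trans mx.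
  by rewrite ler_nat mulnC leq_divM.
rewrite -(@ltr_pM2l _ b%:R)// -natrM; apply: lt_le_trans xm _.
by rewrite ler_nat mulnC ltn_ceil.
Qed.

Lemma digit_prefix_lt n x : x < 1 -> (digit_prefix n x < b ^ n)%N.
Proof.
move=> x1; have [x0|x0] := leP 0 x.
  have nx0 : 0 <= b%:R ^+ n * x by rewrite mulr_ge0// ltW.
  by rewrite truncn_lt_nat// natrX gtr_pMr.
rewrite /digit_prefix truncn_floor ifF ?expn_gt0//; apply/negbTE.
by rewrite -ltNge pmulr_rlt0.
Qed.

Definition prefix_interval (n m : nat) : set R :=
  [set` `[m%:R / b%:R ^+ n, m.+1%:R / b%:R ^+ n[].

Lemma prefix_interval_measure n m :
  lebesgue_measure (prefix_interval n m) = ((b%:R ^+ n)^-1)%:E.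
Proof.
rewrite /prefix_interval lebesgue_measure_itv/= lte_fin ltr_pM2r ?invr_gt0//.
by rewrite ltr_nat ltnSn -EFinD -mulrBl -natrB// subSnn mul1r.
Qed.

Lemma prefix_intervalP n m x : 0 <= x ->
  prefix_interval n m x <-> digit_prefix n x = m.
Proof.
move=> x0; rewrite /prefix_interval/= in_itv/= ler_pdivrMr// ltr_pdivlMr//.
rewrite mulrC; split=> [|<-]; first exact: truncn_def.
by apply: truncn_itv; rewrite mulr_ge0// ltW.
Qed.

Lemma prefix_interval_ge0 n m x : prefix_interval n m x -> 0 <= x.
Proof.
rewrite /prefix_interval/= in_itv/= => /andP[+ _].
by apply: le_trans; rewrite divr_ge0// ltW.
Qed.

(** An event that depends on the first n digits is a disjoint union of intervals
    of length b^-n, so its measure is a count. *)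
Lemma prefix_event_measure n (Q : pred nat) :
  lebesgue_measure ([set x | Q (digit_prefix n x)] `&` [set` `[0, 1[] : set R) =
  ((\sum_(0 <= m < b ^ n) (Q m)%:R) / b%:R ^+ n)%:E.
Proof.
pose s := [seq m <- index_iota 0 (b ^ n) | Q m].
have -> : [set x | Q (digit_prefix n x)] `&` [set` `[0, 1[] =
    \bigcup_(m in [set` s]) prefix_interval n m.
  apply/seteqP; split=> [x [/= Qx]|x [m /=]].
    rewrite in_itv/= => /andP[x0 x1]; exists (digit_prefix n x).
      by rewrite /= mem_filter Qx mem_index_iota digit_prefix_lt.
    exact/prefix_intervalP.
  rewrite mem_filter mem_index_iota /= => /andP[Qm mn] xm.
  have x0 := prefix_interval_ge0 xm.
  split; first by move/(prefix_intervalP _ _ x0): xm => ->.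
  rewrite in_itv/= x0/=; move: xm; rewrite /prefix_interval/= in_itv/=.
  move=> /andP[_ xm]; apply: lt_le_trans xm _.
  by rewrite ler_pdivrMr// mul1r -natrX ler_nat.
rewrite measure_fin_bigcup//=.
- rewrite -fsbig_seq ?filter_uniq ?iota_uniq// big_filter.
  under eq_bigr do rewrite prefix_interval_measure.
  rewrite sumEFin mulr_suml big_mkcond/=; congr (_%:E).
  by apply: eq_bigr => m _; case: (Q m); rewrite ?mul1r ?mul0r.
- move=> i j _ _ [x [xi xj]]; have x0 := prefix_interval_ge0 xi.
  by move/(prefix_intervalP _ _ x0): xi => <-; exact/prefix_intervalP.
- by move=> m _; exact: measurable_itv.
Qed.

Lemma measurable_digit_prefix n (S : set nat) :
  measurable [set x | S (digit_prefix n x)].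
Proof.
have le_meas m : measurable [set x | (digit_prefix n x <= m)%N].
  have -> : [set x | (digit_prefix n x <= m)%N] =
      [set` `]-oo, (m.+1%:R / b%:R ^+ n)[] :> set R.
    apply/seteqP; split=> x /=;
      by rewrite truncn_le_nat in_itv/= ltr_pdivlMr// mulrC.
  exact: measurable_itv.
have -> : [set x | S (digit_prefix n x)] =
    \bigcup_(m in S) [set x | digit_prefix n x = m].
  by apply/seteqP; split=> [x Sx|x [m Sm /= ->]//]; exists (digit_prefix n x).
apply: bigcup_measurable => -[|m] _.
  have -> : [set x | digit_prefix n x = 0%N] =
      [set x | (digit_prefix n x <= 0)%N].
    by apply/seteqP; split=> x /=; rewrite leqn0 => /eqP.
  exact: le_meas.
have -> : [set x | digit_prefix n x = m.+1] =
    [set x | (digit_prefix n x <= m.+1)%N] `\`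
    [set x | (digit_prefix n x <= m)%N].
  apply/seteqP; split=> x /=; first by move=> ->; rewrite ltnn.
  by move=> [xm /negP]; rewrite -ltnNge => mx; apply/eqP; rewrite eqn_leq xm.
exact: measurableD.
Qed.

(** An event on the first n digits of x, as a predicate on their common prefix;
    the recursion consumes the least significant digit, which is the last digit
    of the expansion. *)
Fixpoint accepts E (n m : nat) : bool :=
  if n is n'.+1
  then accepts E n' (m %/ b) && `[< E n' (inord (m %% b)) >] else true.

Lemma acceptsP E n x : 0 <= x ->
  accepts E n (digit_prefix n x) <-> (forall j, (j < n)%N -> E j (digit j x)).
Proof.
move=> x0; elim: n => [//|n [IH1 IH2]] /=; rewrite -digit_prefixS//; split.
  move=> /andP[/IH1 En /asboolP Enn] j.
  by rewrite ltnS leq_eqVlt => /predU1P[->|/En].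
move=> En; apply/andP; split; last by apply/asboolP; exact: En.
by apply: IH2 => j jn; apply: En; exact: ltnW.
Qed.

Definition frequency (F : set 'I_b) : R := (\sum_(i < b) `[< F i >]%:R) / b%:R.

(** Division by b splits the numbers below b^(n+1) into a prefix below b^n and a
    last digit, so the count factors. *)
Lemma sum_accepts E n :
  (\sum_(0 <= m < b ^ n) (accepts E n m)%:R) / b%:R ^+ n =
  \prod_(j < n) frequency (E j).
Proof.
elim: n => [|n IH]; first by rewrite big_ord0 expn0 big_nat1 expr0 divr1.
rewrite big_ord_recr/= -IH expnSr big_nat_mul exprSr.
rewrite [RHS]mulrACA -invfM; congr (_ / _).
rewrite mulr_suml; apply: eq_bigr => i _.
rewrite -{1}[(i * b)%N]add0n big_addn mulSn addnK big_mkord mulr_sumr.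
apply: eq_bigr => r _.
rewrite addnC divnMDl// divn_small// addn0 modnMDl modn_small//.
by rewrite inord_val -natrM mulnb.
Qed.

Lemma digits_event_measure E n :
  lebesgue_measure ([set x | forall j, (j < n)%N -> E j (digit j x)]
    `&` [set` `[0, 1[] : set R) = (\prod_(j < n) frequency (E j))%:E.
Proof.
rewrite -sum_accepts -prefix_event_measure; congr (lebesgue_measure _).
apply/seteqP; split=> x /= [Ex x01]; split => //; move: Ex; apply acceptsP.
  by move: x01; rewrite in_itv/= => /andP[].
by move: x01; rewrite in_itv/= => /andP[].
Qed.

End Digits.

Section DigitLaw.
Context {R : realType} (N : nat).
Local Notation b := (N.+1).

Definition letters (k : int) : measurableType default_measure_display := 'I_b.

Local Notation words := (product_space letters).

(** The coordinate k is the digit at position [pickle k]; distinct integers use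
    distinct positions. *)
Definition digit_word (x : R) : words := fun k => digit N (pickle k) x.

Lemma measurable_digit_word : measurable_fun setT digit_word.
Proof.
apply: (@measurability _ _ _ words setT digit_word (cylinders letters) erefl).
move=> _ [_ [k [E [_ ->]]] <-].
rewrite setTI; exact: (measurable_digit_prefix N _
  [set m | E (inord (m %% b))]).
Qed.

Definition digit_law (W : set words) : \bar R :=
  lebesgue_measure (digit_word @^-1` W `&` [set` `[0, 1[] : set R).

Let measurable_event (W : set words) : measurable W ->
  measurable (digit_word @^-1` W `&` [set` `[0, 1[] : set R).
Proof.
move=> mW; apply: measurableI; last exact: measurable_itv.
by rewrite -[X in measurable X]setTI; exact: measurable_digit_word.
Qed.

Let digit_law0 : digit_law set0 = 0%E.
Proof. by rewrite /digit_law preimage_set0 set0I measure0. Qed.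

Let digit_law_ge0 W : (0 <= digit_law W)%E.
Proof. exact: measure_ge0. Qed.

Let digit_law_sigma_additive : semi_sigma_additive digit_law.
Proof.
move=> F mF tF mUF; rewrite /digit_law preimage_bigcup setI_bigcupl.
apply: measure_semi_sigma_additive => [n||]; first exact: measurable_event.
  apply/trivIsetP => /= i j _ _ ij; rewrite setIACA -preimage_setI.
  by move/trivIsetP : tF => /(_ _ _ _ _ ij) ->//; rewrite preimage_set0 set0I.
by rewrite -setI_bigcupl -preimage_bigcup; exact: measurable_event.
Qed.

HB.instance Definition _ := isMeasure.Build _ _ _ digit_law
  digit_law0 digit_law_ge0 digit_law_sigma_additive.

Let digit_law_setT : digit_law setT = 1%E.
Proof.
rewrite /digit_law preimage_setT setTI lebesgue_measure_itv/= lte01.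
by rewrite sube0.
Qed.

HB.instance Definition _ :=
  Measure_isProbability.Build _ _ _ digit_law digit_law_setT.

Lemma frequency_setT : frequency (setT : set 'I_b) = 1 :> R.
Proof.
rewrite /frequency (eq_bigr (fun=> 1)); last by move=> i _; rewrite asboolT.
by rewrite sumr_const card_ord divff.
Qed.

(** Positions that are not used by J carry no constraint and contribute the
    frequency 1 of the full alphabet. *)
Lemma digit_law_coordinates (J : seq int) (E : int -> set 'I_b) : uniq J ->
  digit_law [set w | forall k, k \in J -> E k (w k)] =
  (\prod_(k <- J) frequency (E k))%:E.
Proof.
move=> uJ; pose n := (\max_(k <- J) (pickle k).+1)%N.
pose F j := if pickle_inv j is Some k
  then (if k \in J then E k else setT) else setT : set 'I_b.
have FE k : k \in J -> F (pickle k) = E k by rewrite /F pickleK_inv => ->.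
have Jn k : k \in J -> (pickle k < n)%N.
  move=> kJ.
  exact: (@leq_bigmax_seq _ J xpredT (fun k => (pickle k).+1) k kJ isT).
have FT j : j \notin map pickle J -> F j = setT.
  rewrite /F; case jk : (pickle_inv j) => [k|//]; case: ifP => // kJ.
  by have := @pickle_invK int j; rewrite jk /= => <-; rewrite map_f.
transitivity (\prod_(j < n) frequency (F j) : R)%:E.
  rewrite -digits_event_measure; congr (lebesgue_measure (_ `&` _)).
  apply/seteqP; split=> x /= Ex.
    move=> j jn; have [/mapP[k kJ ->]|/FT ->//] := boolP (j \in map pickle J).
    by rewrite FE//; exact: Ex.
  by move=> k kJ; have := Ex _ (Jn k kJ); rewrite FE.
congr _%:E; rewrite -(big_mkord xpredT (fun j => frequency (F j))).
rewrite (bigID [in map pickle J])/= [X in _ * X]big1 ?mulr1; last first.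
  by move=> j /FT ->; exact: frequency_setT.
rewrite -big_filter (perm_big (map pickle J)).
  by rewrite big_map; apply: eq_big_seq => k kJ; rewrite FE.
apply: uniq_perm; rewrite ?filter_uniq ?iota_uniq//.
  by rewrite map_inj_uniq//; exact: pcan_inj pickleK_inv.
move=> j; rewrite mem_filter mem_index_iota andb_idr//.
by move=> /mapP[k kJ ->]; exact: Jn.
Qed.

Lemma digit_law_independent : independent_coordinates digit_law.
Proof.
move=> J E uJ _; rewrite [LHS](digit_law_coordinates E uJ) -prodEFin.
apply: eq_bigr => k _; have := @digit_law_coordinates [:: k] E isT.
rewrite big_seq1 => <-; congr digit_law; apply/seteqP; split=> w /= Ew.
  by apply: Ew; rewrite inE.
by move=> l; rewrite inE => /eqP ->.
Qed.

Lemma measurable_letter (k : int) (i : 'I_b) :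
  measurable ([set w | w k = i] : set words).
Proof. by apply: sub_sigma_algebra; exists k, [set i]. Qed.

Lemma digit_law_letter (k : int) (i : 'I_b) :
  digit_law [set w | w k = i] = (b%:R^-1)%:E.
Proof.
have := @digit_law_coordinates [:: k] (fun=> [set i]) isT.
rewrite big_seq1 /frequency (bigD1 i)//= asboolT// big1; last first.
  by move=> j ji; rewrite asboolF// => jiE; rewrite jiE eqxx in ji.
rewrite addr0 mul1r => <-; congr digit_law; apply/seteqP; split=> w /= wi.
  by move=> l; rewrite inE => /eqP ->.
by apply: wi; rewrite inE.
Qed.

End DigitLaw.

(** * Adjacent random dyadic systems *)

Section Adjacent.
Context {R : realType} {X : Type} (rho : X -> X -> R) (A0 delta : R).
Hypotheses (hA0 : 1 <= A0) (hdelta : 0 < delta < 1)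
  (hsmall : 144 * A0 ^+ 8 * delta <= 1).
Hypothesis qm : quasi_metric A0 rho.
Variable A : int -> set nat.

Lemma small_ball_sub_cube (z : int -> nat -> X)
    (Q : int -> nat -> set (qspace rho)) k a (y : X) (r : R) :
  dyadic_properties rho A0 delta A z Q -> A k a ->
  rho y (z k a) < delta ^ (k + 1) -> r <= delta ^ (k + 1) ->
  qball rho y r `<=` Q k a.
Proof.
move=> [_ _ _ balls _] Aa yz rk u uy; apply: (balls k a Aa).1.
have {}uy : rho u y < delta ^ (k + 1) by exact: lt_le_trans uy rk.
apply: lt_le_trans (qm_triangle_lt hA0 qm uy yz) _.
by rewrite scaleS// -mulrDl mulrA ler_pM2r ?scale_gt0// small_ball_cst.
Qed.

Lemma cube_diam_le (z : int -> nat -> X)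
    (Q : int -> nat -> set (qspace rho)) k a :
  dyadic_properties rho A0 delta A z Q -> A k a ->
  (qdiam rho (Q k a) <= (2 * A0 * cst_C1 A0 * delta ^ k)%:E)%E.
Proof.
move=> [_ _ _ balls _] Aa; apply: ge_ereal_sup => _ [u [v [Qu Qv ->]]].
have in_ball q : Q k a q -> rho q (z k a) < cst_C1 A0 * delta ^ k.
  exact: (balls k a Aa).2.
have zv := in_ball v Qv; rewrite (qm_sym qm) in zv.
rewrite lee_fin; apply: ltW.
by apply: lt_le_trans (qm_triangle_lt hA0 qm (in_ball u Qu) zv) _; lra.
Qed.

End Adjacent.

Theorem theorem6p1 (R : realType) (A0 delta : R) (hA0 : 1 <= A0)
    (hdelta : 0 < delta < 1) (hsmall : 144 * A0 ^+ 8 * delta <= 1) :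
  exists C : R, forall A1 : nat, exists K : nat,
  forall (X : Type) (rho : X -> X -> R),
    quasi_metric A0 rho -> geometrically_doubling rho A1 ->
  forall (A : int -> set nat) (x : int -> nat -> X)
         (parent : int -> nat -> nat -> Prop),
    reference_points rho delta A x ->
    reference_parent rho A0 delta A x parent ->
  exists (d : int -> measure_display) (Om : forall k, measurableType (d k))
         (P : probability (product_space Om) R)
         (z : 'I_K -> product_space Om -> int -> nat -> X)
         (Q : 'I_K -> product_space Om -> int -> nat -> set X),
  [/\ forall (w : product_space Om) (t : 'I_K),
        [/\ new_dyadic_points rho A0 delta A x parent (z t w),
            dyadic_system rho A0 delta A (z t w) (Q t w)
          & dyadic_properties rho A0 delta A (z t w) (Q t w)],
      forall (w : product_space Om) (y : X) (r : R), 0 < r ->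
        exists (t : 'I_K) (k : int) (a : nat),
          [/\ A k a, qball rho y r `<=` Q t w k a
            & (qdiam rho (Q t w k a) <= (C * r)%:E)%E]
    & forall t : 'I_K,
        [/\ independent_coordinates P,
            forall k a, A k a -> exists zk : Om k -> X,
              forall w : product_space Om, z t w k a = zk (w k)
          & exists2 tau0 : R, 0 < tau0 &
              forall k a b, A k a -> A (k + 1) b ->
                tree_le A parent (k + 1, b) (k, a) ->
                let E : set (product_space Om) :=
                  [set w | z t w k a = x (k + 1) b] in
                measurable E /\ (tau0%:E <= P E)%E]].
Proof.
(* A ball with delta^(k+2) <= r <= delta^(k+1) goes into a cube of level k,
   whose diameter is at most 2 A0 C1 delta^k. *)
exists (2 * A0 * cst_C1 A0 / delta ^+ 2) => A1.
have [j jP] : exists j, 2 * A0 * (2 * A0) / 2 ^+ j <= delta.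
  by apply: exists_halving; case/andP: hdelta.
pose N := (A1 ^ j)%N; exists N.+1 => X rho qm gd A x parent refx refp.
have [col colP] := choice (fun k =>
  exists_child_coloring hA0 hdelta qm gd refx k jP).
have [sel selP] := choice (fun k =>
  exists_colored_selection hA0 hdelta hsmall qm refx refp (colP k)).
pose z (t : 'I_N.+1) (w : product_space (letters N)) k a :=
  x (k + 1) (sel k (w k + t, a)).
have zP t w : new_dyadic_points rho A0 delta A x parent (z t w).
  exact: (selection_new_dyadic_points hA0 hdelta hsmall qm gd refx refp
    (fun k => w k + t) colP selP).
have system (tw : 'I_N.+1 * product_space (letters N)) :
    exists Q : int -> nat -> set (qspace rho),
      dyadic_system rho A0 delta A (z tw.1 tw.2) Q /\
      dyadic_properties rho A0 delta A (z tw.1 tw.2) Q.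
  have [_ sep dense] := zP tw.1 tw.2.
  apply: (exists_dyadic_system hA0 hdelta hsmall qm gd sep) => k y.
  by have [a [Aa _ ya]] := dense k y; exists a.
have [Q' Q'P] := choice system.
pose Q t w := Q' (t, w).
have QP t w : dyadic_system rho A0 delta A (z t w) (Q t w) /\
    dyadic_properties rho A0 delta A (z t w) (Q t w) := Q'P (t, w).
exists (fun=> default_measure_display), (letters N), (@digit_law R N), z, Q.
split.
- by move=> w t; have [] := QP t w.
- move=> w y r r0; have [k1 /andP[k1r rk1]] := exists_scale hdelta r0.
  pose k := k1 - 1; have k1E : k1 = k + 1 by rewrite /k; lia.
  rewrite k1E in k1r rk1.
  have [b [Ab _ yb]] := refx.2 (k + 1) y.
  have [uniq_parent _ _] := refp; have [a [[Aa ba] _]] := uniq_parent k b Ab.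
  (* The system that uses at level k the colour of the child near y. *)
  pose t : 'I_N.+1 := col k b - w k; exists t, k, a.
  have zb : z t w k a = x (k + 1) b.
    have [_ _ _ h] := selP k (w k + t) a Aa.
    by rewrite /z (h b)// /t addrC subrK.
  have [_ props] := QP t w; split => //.
    apply: (small_ball_sub_cube hA0 hdelta hsmall qm props Aa _ rk1).
    by rewrite zb.
  apply: le_trans (cube_diam_le hA0 qm props Aa) _; rewrite lee_fin.
  rewrite -[leRHS]mulrA ler_pM2l; last first.
    by rewrite mulr_gt0 ?C1_gt0// mulr_gt0// (lt_le_trans ltr01).
  rewrite ler_pdivlMl; last by case/andP: hdelta => *; rewrite exprn_gt0.
  by move: k1r; rewrite !scaleS// mulrA.
- move=> t; split.
  + exact: digit_law_independent.
  + by move=> k a _; exists (fun i => x (k + 1) (sel k (i + t, a))).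
  + exists (N.+1%:R^-1); first by rewrite invr_gt0.
    move=> k a b Aa Ab /tree_le_child ba E.
    have mE : measurable E.
      apply: sub_sigma_algebra; exists k.
      by exists [set i | x (k + 1) (sel k (i + t, a)) = x (k + 1) b].
    split => //; rewrite -(digit_law_letter k (col k b - t)).
    apply: le_measure; rewrite ?inE//; first exact: measurable_letter.
    move=> w /= wk; have [_ _ _ h] := selP k (w k + t) a Aa.
    by rewrite /E/= /z (h b)// wk subrK.
Qed.
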